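(* Let $(d,n)\in\{(3,6),(4,8),(4,12)\}$, let $z\in\mathbb{C}$ with $|z|=1$, and let $\mathcal{C}(d,n,z)=\{|a_z(r)\rangle : r=0,\dots,n-1\}\subset H(d)$ be the explicit set of $n$ normalised vectors (coherent states) defined in the context. Then: (i) (Resolution of the identity) $\frac{d}{n}\sum_{r=0}^{n-1}|a_z(r)\rangle\langle a_z(r)|=\mathbf{1}_d$. (ii) (Orbits) The set $\mathcal{C}(d,n,z)$ is invariant under the cyclic group $\mathcal{G}_d=\{\mathbf{1}_d,X,\dots,X^{d-1}\}$; every vector of $\mathcal{C}(d,n,z)$ has trivial stabiliser in $\mathcal{G}_d$; and $\mathcal{C}(d,n,z)$ is partitioned by $\mathcal{G}_d$ into the $\frac{n}{d}$ orbits $\mathcal{C}_\mu(d,n,z)=\{|a_z(\hat r,\mu)\rangle : \hat r\in\mathbb{Z}_d\}$, $\mu=0,\dots,\frac{n}{d}-1$, each having exactly $d$ elements. Moreover, corresponding states in different orbits are orthogonal: $\langle a_z(\hat r,\mu)|a_z(\hat r,\nu)\rangle=\delta_{\mu\nu}$ for all $\hat r\in\mathbb{Z}_d$ and $\mu,\nu\in\{0,\dots,\frac nd-1\}$. (iii) (Discrete isotropy) The family (counted with multiplicity) of $n$ probabilities $\left(|\langle a_z(r)|a_z(s)\rangle|^2\right)_{s=0,\dots,n-1}$ is the same for all $r\in\{0,\dots,n-1\}$; hence for every $\nu=1,2,3,\dots$ the sum $\sum_{s=0}^{n-1}|\langle a_z(r)|a_z(s)\rangle|^\nu$ does not depend on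 $r$. (iv) (Reproducing kernel) The $n\times n$ matrix $\Pi$ with entries $\Pi_{rs}=\frac{d}{n}\langle a_z(r)|a_z(s)\rangle$ is a projector ($\Pi^2=\Pi=\Pi^\dagger$) of rank $d$, and for every $|f\rangle\in H(d)$ the $n$-tuple $\widetilde f(r)=\sqrt{\frac dn}\,\langle a_z(r)|f\rangle$ satisfies $\sum_{r=0}^{n-1}\Pi_{sr}\widetilde f(r)=\widetilde f(s)$ for all $s$.
   Context: $H(d)=\mathbb{C}^d$ with its standard inner product (antilinear in the first argument) and orthonormal ``position'' basis $|X;s\rangle$, $s\in\mathbb{Z}_d=\{0,\dots,d-1\}$. All vectors and matrices are written in this basis. $X$ is the $d\times d$ cyclic ``upwards displacement'' permutation matrix: $X|X;s\rangle=|X;s-1\rangle$ (indices mod $d$), so $X(v_0,v_1,\dots,v_{d-1})^T=(v_1,\dots,v_{d-1},v_0)^T$. $\mathbf{1}_d$ is the $d\times d$ identity. Coherent states. For $|z|=1$, set $|a_z(\hat r,\mu)\rangle=X^{\hat r}|a_z(0,\mu)\rangle$ for $\hat r\in\{0,\dots,d-1\}$, $\mu\in\{0,\dots,\frac nd-1\}$, and $|a_z(r)\rangle=|a_z(\hat r,\mu)\rangle$ where $r=\hat r+\mu d$, with the following starting vectors: - $\mathcal{C}(3,6,z)$: $|a_z(0,0)\rangle=\frac1{\sqrt2}(1,z,0)^T$, $|a_z(0,1)\rangle=\frac1{\sqrt2}(1,-z,0)^T$. - $\mathcal{C}(4,8,z)$: $|a_z(0,0)\rangle=\frac1{\sqrt2}(z,1,0,0)^T$,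 $|a_z(0,1)\rangle=\frac1{\sqrt2}(z,-1,0,0)^T$. - $\mathcal{C}(4,12,z)$: with $\omega=e^{2\pi i/3}$, $|a_z(0,0)\rangle=\frac1{\sqrt3}(z,1,1,0)^T$, $|a_z(0,1)\rangle=\frac1{\sqrt3}(z,\omega,\omega^2,0)^T$, $|a_z(0,2)\rangle=\frac1{\sqrt3}(z,\omega^2,\omega,0)^T$. *)

(* Defs.v *)
From mathcomp Require Import all_boot all_order all_algebra.
From mathcomp Require Import spectral.
From mathcomp Require Import complex.
From mathcomp Require Import all_classical all_reals all_analysis.

Set Implicit Arguments.
Unset Strict Implicit.
Unset Printing Implicit Defensive.

Import Order.TTheory GRing.Theory Num.Theory.
Local Open Scope classical_set_scope.
Local Open Scope ring_scope.
Local Open Scope complex_scope.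
Local Open Scope sesquilinear_scope.

(* Kets of H(d) are column vectors 'cV[R[i]]_d; the bra of v is its conjugate
   transpose v ^t*. *)

Definition ketbra (R : realType) (d : nat) (u v : 'cV[R[i]]_d) : 'M[R[i]]_d :=
  u *m v ^t*.

Definition braket (R : realType) (d : nat) (u v : 'cV[R[i]]_d) : R[i] :=
  (u ^t* *m v) 0 0.

(* <X;i| X |X;j> = 1 iff i = j - 1 mod d. *)
Definition shiftX (R : realType) (d : nat) : 'M[R[i]]_d :=
  \matrix_(i < d, j < d) ((j : nat) == (i.+1 %% d)%N)%:R.

(* exp(2 pi i / 3) *)
Definition omega3 (R : realType) : R[i] :=
  cos (2 * pi / 3) +i* sin (2 * pi / 3).

(* The starting vectors |a_z(0,mu)>, mu = 0, 1, ..., listed in order by their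
   coordinates.  Only the pairs (d, n) = (3, 6), (4, 8), (4, 12) are
   meaningful. *)
Definition start_coords (R : realType) (d n : nat) (z : R[i]) :
    seq (seq R[i]) :=
  let w := omega3 R in
  let rsqrt (k : R) : R[i] := ((Num.sqrt k)^-1)%:C in
  if (d, n) == (3, 6)%N then
    [:: map ( *%R (rsqrt 2)) [:: 1; z; 0];
        map ( *%R (rsqrt 2)) [:: 1; - z; 0]]
  else if (d, n) == (4, 8)%N then
    [:: map ( *%R (rsqrt 2)) [:: z; 1; 0; 0];
        map ( *%R (rsqrt 2)) [:: z; -1; 0; 0]]
  else if (d, n) == (4, 12)%N then
    [:: map ( *%R (rsqrt 3)) [:: z; 1; 1; 0];
        map ( *%R (rsqrt 3)) [:: z; w; w ^+ 2; 0];
        map ( *%R (rsqrt 3)) [:: z; w ^+ 2; w; 0]]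
  else [::].

Definition start_vec (R : realType) (d n : nat) (z : R[i]) (mu : nat) :
    'cV[R[i]]_d :=
  \col_(i < d) (nth [::] (start_coords d n z) mu)`_i.

(* |a_z(k, mu)> *)
Definition coh2 (R : realType) (d n : nat) (z : R[i]) (k mu : nat) :
    'cV[R[i]]_d :=
  shiftX R d ^+ k *m start_vec d n z mu.

(* |a_z(r)>, with r = k + mu * d and k < d *)
Definition coh (R : realType) (d n : nat) (z : R[i]) (r : nat) :
    'cV[R[i]]_d :=
  coh2 d n z (r %% d) (r %/ d).

Definition cohset (R : realType) (d n : nat) (z : R[i]) : set 'cV[R[i]]_d :=
  [set coh d n z r | r in `I_n].
Arguments cohset {R} d n z.

(* C_mu(d, n, z) *)
Definition cohorbit (R : realType) (d n : nat) (z : R[i]) (mu : nat) :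
    set 'cV[R[i]]_d :=
  [set coh2 d n z k mu | k in `I_d].
Arguments cohorbit {R} d n z mu.

(* G_d = {1, X, ..., X^(d-1)} *)
Definition shiftG (R : realType) (d : nat) : set 'M[R[i]]_d :=
  [set shiftX R d ^+ k | k in `I_d].
Arguments shiftG R d : clear implicits.

Definition orbit_of (R : realType) (d : nat) (G : set 'M[R[i]]_d)
    (v : 'cV[R[i]]_d) : set 'cV[R[i]]_d :=
  [set g *m v | g in G].

Definition stab_of (R : realType) (d : nat) (G : set 'M[R[i]]_d)
    (v : 'cV[R[i]]_d) : set 'M[R[i]]_d :=
  [set g | G g /\ g *m v = v].

(* The n x n kernel matrix Pi *)
Definition repker (R : realType) (d n : nat) (z : R[i]) : 'M[R[i]]_n :=
  \matrix_(r < n, s < n)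
    (d%:R / n%:R * braket (coh d n z r) (coh d n z s)).

Definition symbol (R : realType) (d n : nat) (z : R[i]) (f : 'cV[R[i]]_d)
    (r : nat) : R[i] :=
  (Num.sqrt (d%:R / n%:R : R))%:C * braket (coh d n z r) f.
Arguments symbol {R} d n z f r.

(* Main.v *)
Require Import Defs.
From mathcomp Require Import all_boot all_order all_algebra.
From mathcomp Require Import spectral.
From mathcomp Require Import complex.
From mathcomp Require Import zify ring lra.
From mathcomp Require Import all_classical all_reals all_analysis.

Set Implicit Arguments.
Unset Strict Implicit.
Unset Printing Implicit Defensive.

Import Order.TTheory GRing.Theory Num.Theory.
Local Open Scope classical_set_scope.
Local Open Scope ring_scope.
Local Open Scope complex_scope.
Local Open Scope sesquilinear_scope.

(* Put m = n/d.  In each of the three cases the starting vectors form an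
   orthonormal basis of the span of the first m position states, with all
   coordinates there nonzero.  Averaging the corresponding projector over the
   cyclic shifts gives m times the identity, hence (i) and (iv).  The support
   {0, ..., m-1} is a proper nonempty arc of Z_d, so it has no nontrivial
   translation symmetry, hence (ii).  For (iii), X is unitary, so the Gram row
   of (k, mu) is a cyclic relabelling of the row of (0, mu); and for each shift
   j the moduli |<a(0,mu)|X^j a(0,nu)>| depend on mu and nu only through
   nu - mu, or nu + mu when j = 2, modulo m. *)

(** * Cyclic sums, arcs of Z_d and relabelled rows *)

Lemma sum_divmod (V : nmodType) (F : nat -> V) (m d : nat) :
  \sum_(r < m * d) F r = \sum_(mu < m) \sum_(k < d) F (mu * d + k)%N.
Proof.
elim: m => [|m IHm]; first by rewrite mul0n !big_ord0.
by rewrite mulSnr big_split_ord big_ord_recr IHm.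
Qed.

Lemma sum_cyclic_shift (V : nmodType) (F : nat -> V) (d k : nat) :
  \sum_(i < d) F ((i + k) %% d)%N = \sum_(i < d) F i.
Proof.
elim: k => [|k IHk].
  by apply: eq_bigr => i _; rewrite addn0 modn_small.
rewrite -IHk [RHS](reindex (@ordS d)) /=; last exact: onW_bij (ordS_bij d).
by apply: eq_bigr => i _; rewrite modnDml addSnnS.
Qed.

(** The arc {0, ..., m-1} is entered only between d-1 and 0. If k < k', pulling 0 and d-1 back by k'
    and shifting by k would put another entry at d - (k' - k), which is nonzero mod d. *)
Lemma cyclic_interval_inj (d m k k' : nat) :
    (0 < m < d)%N -> (k < d)%N -> (k' < d)%N ->
    (forall i : 'I_d, ((i + k) %% d < m)%N = ((i + k') %% d < m)%N) ->
  k = k'.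
Proof.
move=> /andP[m0 md].
wlog lek : k k' / (k <= k')%N.
  move=> W kd k'd H; case: (leqP k k') => [/W|/ltnW/W W']; first exact.
  by apply/esym/W' => // i; rewrite H.
move=> kd k'd H; case: (eqVneq k k') => // nek; exfalso.
have lek' : (k < k')%N by rewrite ltn_neqAle nek.
have i1 : (d - k' < d)%N by lia.
have i2 : (d.-1 - k' < d)%N by lia.
have := H (Ordinal i1); have := H (Ordinal i2); rewrite /= .
rewrite (subnK (ltnW k'd)) modnn m0.
rewrite [(d.-1 - k' + k')%N]subnK; last lia.
rewrite !modn_small; lia.
Qed.

(** Each row is compared with row 0 only. Relabellings act on [iota 0 n] rather than on ordinals, so
    that being a permutation can be settled by computation. *)
Lemma perm_rows (T : eqType) (n : nat) (F : nat -> nat -> T)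
    (g : nat -> nat -> nat) :
    (forall r s, (r < n)%N -> (s < n)%N -> F r s = F 0%N (g r s)) ->
    (forall r, (r < n)%N -> perm_eq [seq g r s | s <- iota 0 n] (iota 0 n)) ->
  forall r r' : 'I_n, perm_eq [seq F r s | s : 'I_n] [seq F r' s | s : 'I_n].
Proof.
move=> Fg g_perm r r'.
have row0 (t : 'I_n) :
    perm_eq [seq F t s | s : 'I_n] [seq F 0%N s | s <- iota 0 n].
  have -> : [seq F t s | s : 'I_n] =
      [seq F 0%N s | s <- [seq g t s | s <- iota 0 n]].
    transitivity [seq F t s | s <- iota 0 n].
      by rewrite -val_enum_ord -map_comp.
    rewrite -map_comp; apply/eq_in_map => s; rewrite mem_iota /= => sn.
    exact: Fg.
  exact/perm_map/g_perm.
by rewrite (perm_trans (row0 r)) // perm_sym row0.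
Qed.

Lemma perm_image_comp (I : finType) (T U : eqType) (f : T -> U) (F G : I -> T) :
  perm_eq [seq F i | i : I] [seq G i | i : I] ->
  perm_eq [seq f (F i) | i : I] [seq f (G i) | i : I].
Proof. by move/(perm_map f); rewrite -(map_comp f F) -(map_comp f G). Qed.

Lemma sum_perm_image (I : finType) (V : nmodType) (F G : I -> V) :
  perm_eq [seq F i | i : I] [seq G i | i : I] ->
  \sum_i F i = \sum_i G i.
Proof.
move=> FG; transitivity (\sum_(x <- [seq F i | i : I]) x).
  by rewrite big_image.
by rewrite (perm_big _ FG) big_image.
Qed.

(** * The cyclic shift in coordinates *)

Definition start_coord (R : realType) (d n : nat) (z : R[i]) (mu a : nat) : R[i] :=
  (nth [::] (start_coords d n z) mu)`_a.

Lemma shiftX_mulE (R : realType) (d : nat) (v : 'cV[R[i]]_d) (i : 'I_d) :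
  (shiftX R d *m v) i 0 = v (ordS i) 0.
Proof.
rewrite mxE (bigD1 (ordS i)) //= mxE eqxx mul1r big1 ?addr0 // => j.
by rewrite -val_eqE /= mxE => /negPf->; rewrite mul0r.
Qed.

Lemma braket_shiftX (R : realType) (d k : nat) (u v : 'cV[R[i]]_d) :
  braket (shiftX R d ^+ k *m u) (shiftX R d ^+ k *m v) = braket u v.
Proof.
elim: k => [|k IHk]; first by rewrite expr0 !mul1mx.
rewrite -IHk !exprS -!mulmxA; move: (_ *m u) (_ *m v) => {IHk} {}u {}v.
rewrite /braket !mxE [RHS](reindex (@ordS d)) /=; last exact: onW_bij (ordS_bij d).
by apply: eq_bigr => i _; rewrite 2![in LHS]mxE [in RHS]mxE [in RHS]mxE !shiftX_mulE.
Qed.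

(** * Coherent states generated by abstract starting vectors *)

Section Frame.
Variables (R : realType) (d n m : nat) (z : R[i]).
Implicit Types (k mu nu : nat).

Let c := start_coord d n z.

Hypothesis m_bounds : (0 < m < d)%N.
Hypothesis n_eq : n = (m * d)%N.

Let m_gt0 : (0 < m)%N. Proof. by case/andP: m_bounds. Qed.
Let d_gt0 : (0 < d)%N. Proof. by case/andP: m_bounds => m0 /(ltn_trans m0). Qed.
Let n_div : (n %/ d)%N = m. Proof. by rewrite n_eq mulnK. Qed.

Lemma coh2E k mu (i : 'I_d) : coh2 d n z k mu i 0 = c mu ((i + k) %% d)%N.
Proof.
rewrite /coh2; elim: k i => [|k IHk] i.
  by rewrite expr0 mul1mx mxE addn0 modn_small.
by rewrite exprS -mulmxA shiftX_mulE IHk /= modnDml addSnnS.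
Qed.

Lemma coh2_mod k mu : coh2 d n z (k %% d) mu = coh2 d n z k mu.
Proof. by apply/colP => i; rewrite !coh2E modnDmr. Qed.

Lemma shiftX_coh2 j k mu :
  shiftX R d ^+ j *m coh2 d n z k mu = coh2 d n z (j + k) mu.
Proof. by rewrite /coh2 mulmxA exprD. Qed.

Lemma cohE k mu : (k < d)%N -> coh d n z (mu * d + k) = coh2 d n z k mu.
Proof.
by move=> kd; rewrite /coh modnMDl modn_small // divnMDl // divn_small // addn0.
Qed.

Lemma braket_coh2E k k' mu nu : braket (coh2 d n z k mu) (coh2 d n z k' nu) =
  \sum_(i < d) (c mu ((i + k) %% d)%N)^*%R * c nu ((i + k') %% d)%N.
Proof.
rewrite /braket mxE; apply: eq_bigr => i _.
by rewrite mxE [X in X^*%R]mxE !coh2E.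
Qed.

Lemma braket_coh2_base k k' mu nu : (k < d)%N ->
  braket (coh2 d n z k mu) (coh2 d n z k' nu) =
  braket (coh2 d n z 0 mu) (coh2 d n z ((k' + d - k) %% d) nu).
Proof.
(* Unitarity cancels X^k; adding d before subtracting k keeps the truncated subtraction exact. *)
move=> kd; rewrite coh2_mod -[RHS](braket_shiftX k) !shiftX_coh2 addn0 subnKC.
  by rewrite -[coh2 _ _ _ (k' + d) nu]coh2_mod modnDr coh2_mod.
by rewrite ltnW // ltn_addl.
Qed.

Hypothesis orthonormal_start : forall mu nu, (mu < m)%N -> (nu < m)%N ->
  \sum_(i < d) (c mu i)^*%R * c nu i = (mu == nu)%:R.
(* With the previous hypothesis: the starting vectors are an orthonormal basis
   of the span of the first m position states. *)
Hypothesis complete_start : forall a b, (a < d)%N -> (b < d)%N ->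
  \sum_(mu < m) c mu a * (c mu b)^*%R = ((a == b) && (a < m)%N)%:R.
Hypothesis support_start : forall mu a, (mu < m)%N -> (a < d)%N ->
  (c mu a == 0) = (m <= a)%N.

Lemma braket_coh2 k mu nu : (mu < m)%N -> (nu < m)%N ->
  braket (coh2 d n z k mu) (coh2 d n z k nu) = (mu == nu)%:R.
Proof.
move=> mum num; rewrite braket_coh2E -(orthonormal_start mum num).
exact: (@sum_cyclic_shift _ (fun a => (c mu a)^*%R * c nu a)).
Qed.

(** The support is a translated arc, which determines the shift; at equal shifts, orthonormality
    separates mu from nu. *)
Lemma coh2_inj k k' mu nu : (k < d)%N -> (k' < d)%N -> (mu < m)%N ->
  (nu < m)%N -> coh2 d n z k mu = coh2 d n z k' nu -> k = k' /\ mu = nu.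
Proof.
move=> kd k'd mum num E.
have kk' : k = k'.
  apply: (cyclic_interval_inj m_bounds) => // i.
  have supp j la : (la < m)%N ->
      (((i + j) %% d)%N < m)%N = (coh2 d n z j la i 0 != 0).
    by move=> lam; rewrite coh2E support_start ?ltn_pmod // ltnNge.
  by rewrite (supp k mu) // (supp k' nu) // E.
split=> //; apply/eqP; have := braket_coh2 k mum num.
rewrite -kk' in E; rewrite -E braket_coh2 // eqxx.
by case: eqP => // _ /eqP; rewrite oner_eq0.
Qed.

(** * Resolution of the identity *)

(** In entry (i, j), completeness reduces the sum over mu to the indicator of i = j and (i + k) mod
    d < m; as k runs over Z_d, the second condition holds m times. *)
Lemma resolution_sum : \sum_(r < n) ketbra (coh d n z r) (coh d n z r) = m%:R%:M.
Proof.
have sumE (F : nat -> 'M[R[i]]_d) :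
    \sum_(r < n) F r = \sum_(k < d) \sum_(mu < m) F (mu * d + k)%N.
  by rewrite n_eq sum_divmod exchange_big.
rewrite (sumE (fun r => ketbra (coh d n z r) (coh d n z r))).
apply/matrixP => i j; rewrite summxE.
pose F a := ((a < m)%N)%:R : R[i].
transitivity (\sum_(k < d) ((i == j)%:R * F ((i + k) %% d)%N)).
  apply: eq_bigr => k _; rewrite summxE.
  transitivity (\sum_(mu < m)
      c mu ((i + k) %% d)%N * (c mu ((j + k) %% d)%N)^*%R).
    apply: eq_bigr => mu _; rewrite cohE // /ketbra mxE big_ord_recl big_ord0.
    by rewrite addr0 [X in _ * X]mxE [X in X^*%R]mxE !coh2E.
  rewrite complete_start ?ltn_pmod // eqn_modDr !(modn_small (ltn_ord _)).
  by rewrite -mulnb natrM.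
rewrite -mulr_sumr (eq_bigr (fun k : 'I_d => F ((k + i) %% d)%N)); last first.
  by move=> k _; rewrite addnC.
rewrite sum_cyclic_shift !mxE /F mulr_natl; congr (_ *+ _).
case/andP: m_bounds => _ /ltnW md; rewrite (bigID (fun k : 'I_d => (k < m)%N)) /=.
rewrite [X in _ + X]big1 ?addr0; last by move=> k /negPf->.
rewrite (eq_bigr (fun => 1)); last by move=> k ->.
by rewrite -(big_ord_widen d (fun => 1) md) sumr_const card_ord.
Qed.

Lemma resolution_of_identity :
  (d%:R / n%:R : R[i]) *: \sum_(r < n) ketbra (coh d n z r) (coh d n z r) = 1%:M.
Proof.
have d0 : (d%:R : R[i]) != 0 by rewrite pnatr_eq0 -lt0n.
have m0 : (m%:R : R[i]) != 0 by rewrite pnatr_eq0 -lt0n.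
rewrite resolution_sum scale_scalar_mx n_eq natrM; congr (_%:M).
by field; rewrite d0 m0.
Qed.

(** * Orbits and stabilisers under the cyclic group *)

Let cohP v : cohset d n z v ->
  exists k mu, [/\ (k < d)%N, (mu < m)%N & v = coh2 d n z k mu].
Proof.
case=> r /= rn <-; exists (r %% d)%N, (r %/ d)%N.
by rewrite ltn_pmod // ltn_divLR // -n_eq.
Qed.

Let cohset_coh2 k mu : (mu < m)%N -> cohset d n z (coh2 d n z k mu).
Proof.
move=> mum; exists (mu * d + k %% d)%N; last by rewrite cohE ?ltn_pmod ?coh2_mod.
rewrite /= n_eq; apply: (@leq_trans (mu.+1 * d)); last by rewrite leq_mul2r mum orbT.
by rewrite mulSnr ltn_add2l ltn_pmod.
Qed.

Let cohorbit_coh2 k mu : cohorbit d n z mu (coh2 d n z k mu).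
Proof. by exists (k %% d)%N; rewrite /= ?ltn_pmod ?coh2_mod. Qed.

Lemma cohset_invariant g : shiftG R d g ->
  [set g *m v | v in cohset d n z] = cohset d n z.
Proof.
case=> j /= jd <-; apply/seteqP; split=> [_ [v /cohP[k [mu [kd mum ->]]] <-]|].
  by rewrite shiftX_coh2; apply: cohset_coh2.
move=> v /cohP[k [mu [kd mum ->]]].
(* X^(d-j) inverts X^j. *)
exists (coh2 d n z (d - j + k) mu); first exact: cohset_coh2.
by rewrite shiftX_coh2 addnA subnKC ?(ltnW jd) // -coh2_mod modnDl coh2_mod.
Qed.

Lemma stab_coh v : cohset d n z v -> stab_of (shiftG R d) v = [set 1%:M].
Proof.
case/cohP=> k [mu [kd mum ->]]; apply/seteqP; split=> [g [[j /= jd <-]]|g ->].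
  rewrite shiftX_coh2 -coh2_mod => /coh2_inj[] //; first by rewrite ltn_pmod.
  move=> jk _; suff -> : j = 0%N by rewrite expr0.
  have /eqP : (j + k = 0 + k %[mod d])%N by rewrite add0n jk modn_small.
  by rewrite eqn_modDr mod0n modn_small // => /eqP.
by split; rewrite ?mul1mx //; exists 0%N; rewrite ?expr0.
Qed.

Lemma cohorbit_partition :
  partition `I_(n %/ d) (cohorbit d n z) (cohset d n z).
Proof.
rewrite n_div; split=> [|mu nu /= mum num|mu _]; last first.
- by exists (coh2 d n z 0 mu); apply: cohorbit_coh2.
- by case=> v [[k /= kd <-] [k' /= k'd] /esym/coh2_inj[]].
apply/seteqP; split=> [_ [mu /= mum [k /= kd <-]]|_ /cohP[k [mu [kd mum ->]]]].
  exact: cohset_coh2.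
by exists mu => //; apply: cohorbit_coh2.
Qed.

Let orbit_coh2 k mu : orbit_of (shiftG R d) (coh2 d n z k mu) = cohorbit d n z mu.
Proof.
apply/seteqP; split=> [_ [_ [j /= jd <-] <-]|_ [j /= jd <-]].
  by rewrite shiftX_coh2; apply: cohorbit_coh2.
(* The exponent is j - k mod d; k is reduced first so that the subtraction from d does not
   truncate. *)
exists (shiftX R d ^+ ((j + (d - k %% d)) %% d)).
  by exists ((j + (d - k %% d)) %% d)%N => //=; rewrite ltn_pmod.
rewrite -[coh2 _ _ _ k mu]coh2_mod shiftX_coh2 -coh2_mod modnDml -addnA subnK.
  by rewrite modnDr coh2_mod.
by rewrite ltnW // ltn_pmod.
Qed.

Lemma cohset_orbits :
  [set orbit_of (shiftG R d) v | v in cohset d n z] =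
  [set cohorbit d n z mu | mu in `I_(n %/ d)].
Proof.
rewrite n_div; apply/seteqP; split=> [_ [_ /cohP[k [mu [kd mum ->]]] <-]|_ [mu /= mum <-]].
  by exists mu; rewrite ?orbit_coh2.
by exists (coh2 d n z 0 mu); [exact: cohset_coh2 | exact: orbit_coh2].
Qed.

Lemma card_cohorbit mu : (mu < n %/ d)%N -> (cohorbit d n z mu #= `I_d)%card.
Proof.
rewrite n_div => mum; apply: inj_card_eq => k k'.
by rewrite !inE /= => kd k'd /coh2_inj[].
Qed.

(** * Reproducing kernel *)

(* The columns of V are the coherent states: Pi is (d/n) V^* V while the
   resolution of the identity says (d/n) V V^* = 1. *)
Let V := \matrix_(i < d, r < n) coh d n z r i 0.
Let q : R[i] := d%:R / n%:R.

Let frame_coisometry : q *: (V *m V ^t*) = 1%:M.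
Proof.
rewrite -resolution_of_identity; congr (_ *: _); apply/matrixP => i j.
rewrite summxE mxE; apply: eq_bigr => r _.
by rewrite /ketbra !mxE big_ord_recl big_ord0 addr0 !mxE.
Qed.

Let braketE u v : braket u v = \sum_(i < d) (u i 0)^*%R * v i 0 :> R[i].
Proof. by rewrite /braket mxE; apply: eq_bigr => i _; rewrite !mxE. Qed.

Let repkerE : repker d n z = q *: (V ^t* *m V).
Proof.
apply/matrixP => r s; rewrite !mxE braketE; congr (_ * _).
by apply: eq_bigr => i _; rewrite !mxE.
Qed.

Lemma repker_idem : repker d n z *m repker d n z = repker d n z.
Proof.
rewrite repkerE -scalemxAr -scalemxAl mulmxA -(mulmxA (V ^t*)).
by congr (_ *: _); rewrite scalemxAl scalemxAr frame_coisometry mulmx1.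
Qed.

Lemma repker_herm : (repker d n z) ^t* = repker d n z.
Proof.
apply/matrixP => r s; rewrite !mxE rmorphM /= fmorph_div !rmorph_nat.
congr (_ * _); rewrite !braketE rmorph_sum; apply: eq_bigr => i _.
by rewrite rmorphM /= conjCK mulrC.
Qed.

Lemma repker_rank : \rank (repker d n z) = d.
Proof.
apply/eqP; rewrite eqn_leq; apply/andP; split.
  rewrite repkerE scalemxAr; apply: leq_trans (mxrankM_maxr _ _) _.
  by apply: leq_trans (mxrank_scale _ _) _; apply: rank_leq_row.
have E : V *m repker d n z *m (q *: V ^t*) = 1%:M.
  have -> : V *m repker d n z = V.
    by rewrite repkerE -scalemxAr mulmxA scalemxAl frame_coisometry mul1mx.
  by rewrite -scalemxAr frame_coisometry.
rewrite -[X in (X <= _)%N](mxrank1 R[i] d) -E.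
exact: leq_trans (mxrankM_maxl _ _) (mxrankM_maxr _ _).
Qed.

(** The symbol of f is a scalar multiple of V^* f, and Pi V^* = V^*. *)
Lemma repker_symbol (f : 'cV[R[i]]_d) (s : 'I_n) :
  \sum_(r < n) repker d n z s r * symbol d n z f r = symbol d n z f s.
Proof.
have symE (r : 'I_n) : symbol d n z f r =
    (Num.sqrt (d%:R / n%:R : R))%:C * (V ^t* *m f) r 0.
  rewrite /symbol braketE mxE; congr (_ * _).
  by apply: eq_bigr => i _; rewrite !mxE.
under eq_bigr do rewrite symE mulrCA.
rewrite -mulr_sumr symE; congr (_ * _).
transitivity ((repker d n z *m (V ^t* *m f)) s 0); first by rewrite [RHS]mxE.
rewrite repkerE mulmxA -scalemxAl -mulmxA scalemxAr frame_coisometry.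
by rewrite mulmx1.
Qed.

(** * Discrete isotropy *)

(* Row (k, mu) of the Gram matrix is row 0 up to phases, after relabelling the
   column (k', nu) as (k' - k, phi j mu nu) where j = k' - k mod d. *)
Variable phi : nat -> nat -> nat -> nat.
Let relabel r s :=
  let j := ((s %% d + d - r %% d) %% d)%N in (phi j (r %/ d) (s %/ d) * d + j)%N.
Hypothesis isotropic_start : forall j mu nu,
  (j < d)%N -> (mu < m)%N -> (nu < m)%N ->
  `|braket (coh2 d n z 0 mu) (coh2 d n z j nu)| =
  `|braket (coh2 d n z 0 0) (coh2 d n z j (phi j mu nu))|.
Hypothesis relabel_perm : forall r, (r < n)%N ->
  perm_eq [seq relabel r s | s <- iota 0 n] (iota 0 n).

Lemma perm_braket_row (r r' : 'I_n) :
  perm_eq [seq `|braket (coh d n z r) (coh d n z s)| | s : 'I_n]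
          [seq `|braket (coh d n z r') (coh d n z s)| | s : 'I_n].
Proof.
pose F (r s : nat) := `|braket (coh d n z r) (coh d n z s)|.
apply: (@perm_rows _ _ F relabel _ relabel_perm) => t s tn sn.
have lt_mod a : (a %% d < d)%N by exact: ltn_pmod.
have lt_div a : (a < n)%N -> (a %/ d < m)%N by rewrite n_eq ltn_divLR.
rewrite /F /relabel cohE; last exact: lt_mod.
rewrite {1 2 3}/coh mod0n div0n braket_coh2_base; last exact: lt_mod.
exact: isotropic_start (lt_mod _) (lt_div _ tn) (lt_div _ sn).
Qed.

End Frame.

(** * Algebraic conditions on the starting vectors *)

(* The index replacing nu when mu is replaced by 0.  For (4, 12), up to a phase,
   3 <a(0,mu)|X^j a(0,nu)> is conj z + w^(nu-mu) at j = 1,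
   z + conj z * w^(2(nu+mu)) at j = 2 and z + w^(nu-mu) at j = 3; for m = 2 the
   two branches agree. *)
Definition match_index (m j mu nu : nat) : nat :=
  ((if j == 2 then nu + mu else nu + (m - mu)) %% m)%N.

(** Gathers what the frame argument needs of the coordinates: orthonormality, completeness, support
    and isotropy. Here [gram j mu nu] is <a(0,mu)|X^j a(0,nu)>. *)
Definition fiducial (C : numClosedFieldType) (d m : nat) (c : nat -> nat -> C) :=
  let gram j mu nu := \sum_(i < d) (c mu i)^*%R * c nu ((i + j) %% d)%N in
  [/\ forall mu nu, (mu < m)%N -> (nu < m)%N ->
        \sum_(i < d) (c mu i)^*%R * c nu i = (mu == nu)%:R,
      forall a b, (a < d)%N -> (b < d)%N ->
        \sum_(mu < m) c mu a * (c mu b)^*%R = ((a == b) && (a < m)%N)%:R,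
      forall mu a, (mu < m)%N -> (a < d)%N -> (c mu a == 0) = (m <= a)%N &
      forall j mu nu, (j < d)%N -> (mu < m)%N -> (nu < m)%N ->
        `|gram j mu nu| = `|gram j 0%N (match_index m j mu nu)|].

(** * The three families, with s the normalising factor *)

Section Fiducial.
Variables (C : numClosedFieldType) (s z w : C).
Hypothesis s_real : s^*%R = s.
Hypothesis z_unit : z * z^*%R = 1.

Let unit_neq0 (x y : C) : x * y = 1 -> x != 0.
Proof. by apply: contra_eq_neq => ->; rewrite mul0r eq_sym oner_eq0. Qed.

Let z_neq0 : z != 0. Proof. exact: unit_neq0 z_unit. Qed.

(** Turns an equality of moduli into a polynomial identity, once the relating phase u is
    supplied. *)
Let eq_norm_unit (u a b : C) : `|u| = 1 -> a = u * b -> `|a| = `|b|.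
Proof. by move=> u1 ->; rewrite normrM u1 mul1r. Qed.

Let simpE := (rmorphM, rmorphN, rmorph0, rmorph1, rmorphXn, rmorphN1).

Lemma fiducial_3_6 : s * s * 2 = 1 ->
  fiducial 3 2 (fun mu a => s * [:: 1; (-1) ^+ mu * z; 0]`_a).
Proof.
move=> s2; have s0 : s != 0 by move: s2; rewrite -mulrA => /unit_neq0.
split.
- case=> [|[|//]] [|[|//]] _ _; rewrite !big_ord_recl big_ord0 /= !simpE /= ?s_real;
    ring: s2 z_unit.
- case=> [|[|[|//]]] [|[|[|//]]] _ _;
    rewrite !big_ord_recl big_ord0 /= !simpE /= ?s_real; ring: s2 z_unit.
- by case=> [|[|//]] [|[|[|//]]] _ _; rewrite /= !mulf_eq0 (negPf s0)
    ?(negPf z_neq0) ?expr0 ?expr1 ?oppr_eq0 ?oner_eq0 ?eqxx.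
move=> j mu nu jd mum num.
(* At j = 0 both sides depend on mu + nu mod 2 only; at j = 1, 2 a single product survives, and
   replacing mu by 0 extracts its sign. *)
apply: (@eq_norm_unit (if j == 0 then 1 else (-1) ^+ mu)).
  by case: ifP; rewrite ?normrX ?normrN normr1 ?expr1n.
by case: j jd => [|[|[|//]]] _; case: mu mum => [|[|//]] _;
  case: nu num => [|[|//]] _;
  rewrite !big_ord_recl !big_ord0 /= !simpE /= ?s_real; ring.
Qed.

Lemma fiducial_4_8 : s * s * 2 = 1 ->
  fiducial 4 2 (fun mu a => s * [:: z; (-1) ^+ mu; 0; 0]`_a).
Proof.
move=> s2; have s0 : s != 0 by move: s2; rewrite -mulrA => /unit_neq0.
split.
- case=> [|[|//]] [|[|//]] _ _; rewrite !big_ord_recl big_ord0 /= !simpE /= ?s_real;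
    ring: s2 z_unit.
- case=> [|[|[|[|//]]]] [|[|[|[|//]]]] _ _;
    rewrite !big_ord_recl big_ord0 /= !simpE /= ?s_real; ring: s2 z_unit.
- by case=> [|[|//]] [|[|[|[|//]]]] _ _; rewrite /= !mulf_eq0 (negPf s0)
    ?(negPf z_neq0) ?expr0 ?expr1 ?oppr_eq0 ?oner_eq0 ?eqxx.
move=> j mu nu jd mum num.
(* Same phases, now at j = 1 and j = 3; at j = 2 the supports are disjoint and both sides vanish. *)
apply: (@eq_norm_unit (if j == 0 then 1 else (-1) ^+ mu)).
  by case: ifP; rewrite ?normrX ?normrN normr1 ?expr1n.
by case: j jd => [|[|[|[|//]]]] _; case: mu mum => [|[|//]] _;
  case: nu num => [|[|//]] _;
  rewrite !big_ord_recl !big_ord0 /= !simpE /= ?s_real; ring.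
Qed.

(** The two relations on w capture a primitive cube root of unity without trigonometry. *)
Lemma fiducial_4_12 : s * s * 3 = 1 -> w ^+ 2 = - 1 - w -> w^*%R = w ^+ 2 ->
  fiducial 4 3 (fun mu a => s * [:: z; w ^+ mu; w ^+ (2 * mu); 0]`_a).
Proof.
move=> s2 w2 wJ.
have s0 : s != 0 by move: s2; rewrite -mulrA => /unit_neq0.
have w3 : w ^+ 3 = 1 by ring: w2.
have w0 : w != 0 by move: w3; rewrite exprS => /unit_neq0.
have w1 : `|w| = 1.
  by apply/(pexpIrn (n := 2)); rewrite ?nnegrE // normCK wJ -exprS w3 expr1n.
split.
- case=> [|[|[|//]]] [|[|[|//]]] _ _;
    rewrite !big_ord_recl big_ord0 /= !simpE /= ?s_real wJ; ring: s2 z_unit w2.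
- case=> [|[|[|[|//]]]] [|[|[|[|//]]]] _ _;
    rewrite !big_ord_recl big_ord0 /= !simpE /= ?s_real ?wJ; ring: s2 z_unit w2.
- by case=> [|[|[|//]]] [|[|[|[|//]]]] _ _; rewrite /= !mulf_eq0 (negPf s0)
    ?(negPf z_neq0) ?expf_eq0 /= ?(negPf w0) ?oner_eq0 ?eqxx.
move=> j mu nu jd mum num.
(* Exponents of the phase for j = 0, 1, 2, 3. At j = 1 the prefactor w^nu becomes w^(nu-mu); at j =
   2 and j = 3 the prefactors w^mu and w^(-mu) = w^(2 mu) become 1. *)
apply: (@eq_norm_unit (w ^+ (nth 0 [:: 0; mu; mu; 2 * mu] j)%N)).
  by rewrite normrX w1 expr1n.
by case: j jd => [|[|[|[|//]]]] _; case: mu mum => [|[|[|//]]] _;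
  case: nu num => [|[|[|//]]] _;
  rewrite !big_ord_recl !big_ord0 /= !simpE /= ?s_real ?wJ; ring: w2.
Qed.

End Fiducial.

(** * The cube root of unity and the normalising factors *)

(** Since 2x = 2 pi - x, the cosine satisfies c = 2 c^2 - 1, so c is 1 or -1/2; sin x > 0 rules out
    1. *)
Lemma cos_2pi3 (R : realType) : cos (2 * pi / 3) = - 2^-1 :> R.
Proof.
set x := 2 * pi / 3; have pi0 := pi_gt0 R.
have c2 : cos x = cos x ^+ 2 *+ 2 - 1.
  rewrite -cos_mulr2n -[LHS]cosN -[LHS]cosD2pi; congr cos.
  by rewrite /x !mulr2n; field.
have sx0 : 0 < sin x by apply: sin_gt0_pi; rewrite /x; lra.
have cs := cos2Dsin2 x.
have : (cos x - 1) * (cos x + 2^-1) = 0 by lra.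
move/eqP; rewrite mulf_eq0 => /orP[/eqP E|/eqP E]; last lra.
have : 0 < sin x ^+ 2 by rewrite exprn_gt0.
by rewrite (_ : cos x = 1) in cs; lra.
Qed.

Lemma omega3_sqr (R : realType) : omega3 R ^+ 2 = (omega3 R)^*%R.
Proof.
have := cos2Dsin2 (2 * pi / 3 : R); rewrite /omega3 cos_2pi3.
(* The sine enters only through y^2 = 3/4, so it can be generalised. *)
move: (sin _) => y yE; apply/eqP; rewrite eq_complex /=.
by apply/andP; split; apply/eqP; lra.
Qed.

Lemma omega3_quadratic (R : realType) : omega3 R ^+ 2 = - 1 - omega3 R.
Proof.
rewrite omega3_sqr /omega3 cos_2pi3.
by apply/eqP; rewrite eq_complex /=; apply/andP; split; apply/eqP; lra.
Qed.

Lemma rsqrt_sqr (R : realType) (k : nat) : (0 < k)%N ->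
  ((Num.sqrt (k%:R : R))^-1)%:C * ((Num.sqrt (k%:R : R))^-1)%:C * k%:R = 1 :> R[i].
Proof.
move=> k0; rewrite -rmorphM /= -invfM -expr2 sqr_sqrtr ?ler0n //.
by rewrite -[X in _ * X](rmorph_nat (real_complex R)) -rmorphM /= mulVf ?pnatr_eq0 -?lt0n.
Qed.

(** * Transfer to the tabulated starting vectors *)

(** The conditions read coordinates only in range: m > 0 covers row 0 and keeps [match_index] below
    m. *)
Lemma eq_fiducial (C : numClosedFieldType) (d m : nat) (c c' : nat -> nat -> C) :
  (0 < m)%N ->
  (forall mu a, (mu < m)%N -> (a < d)%N -> c' mu a = c mu a) ->
  fiducial d m c -> fiducial d m c'.
Proof.
move=> m0 E [ orth full supp iso]; split.
- move=> mu nu mum num; rewrite -orth //; apply: eq_bigr => i _.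
  by rewrite !E.
- move=> a b ad bd; rewrite -full //; apply: eq_bigr => i _.
  by rewrite !E.
- by move=> mu a mum ad; rewrite E // supp.
move=> j mu nu jd mum num.
have gE la ka : (la < m)%N -> (ka < m)%N ->
    \sum_(i < d) (c' la i)^*%R * c' ka ((i + j) %% d)%N =
    \sum_(i < d) (c la i)^*%R * c ka ((i + j) %% d)%N.
  move=> lam kam; apply: eq_bigr => i _.
  by rewrite !E // ltn_pmod // (leq_trans _ jd).
rewrite (gE _ _ mum num) gE //; last exact: ltn_pmod.
exact: iso.
Qed.

Lemma fiducial_coord (R : realType) (d n : nat) (z : R[i]) :
  (d, n) \in [:: (3, 6)%N; (4, 8)%N; (4, 12)%N] -> `|z| = 1 ->
  fiducial d (n %/ d) (start_coord d n z).
Proof.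
move=> dn z1.
have zz : z * z^*%R = 1 by rewrite -normCK z1 expr1n.
have sJ (x : R) : (x%:C)^*%R = x%:C by apply: conjc_real.
have [s2 s3] := (@rsqrt_sqr R 2 isT, @rsqrt_sqr R 3 isT).
have w2 := omega3_quadratic R; have wJ := esym (omega3_sqr R).
move: dn; rewrite !inE => /or3P[] /eqP[-> ->].
- apply: eq_fiducial (fiducial_3_6 (sJ _) zz s2) => //.
  by case=> [|[|//]] [|[|[|//]]] _ _; rewrite /start_coord /= ?mulr0 ?expr0 ?mul1r ?expr1 ?mulN1r.
- apply: eq_fiducial (fiducial_4_8 (sJ _) zz s2) => //.
  by case=> [|[|//]] [|[|[|[|//]]]] _ _; rewrite /start_coord /= ?mulr0 ?expr0 ?mulr1 ?expr1.
- apply: eq_fiducial (fiducial_4_12 (sJ _) zz s3 w2 wJ) => //.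
  (* The third starting vector is tabulated with w where the formula gives w^(2 * 2). *)
  have w4 : omega3 R ^+ 4 = omega3 R by ring: w2.
  by case=> [|[|[|//]]] [|[|[|[|//]]]] _ _; rewrite /start_coord /= ?w4 ?mulr0 ?expr0 ?expr1.
Qed.

(** * The four assertions for the three families *)

Theorem mainTheorem1 (R : realType) (d n : nat)
    (hdn : (d, n) \in [:: (3, 6)%N; (4, 8)%N; (4, 12)%N])
    (z : R[i]) (hz : `|z| = 1) :
  (* (i) resolution of the identity *)
  ((d%:R / n%:R : R[i]) *:
     \sum_(r < n) ketbra (coh d n z r) (coh d n z r) = 1%:M)
  /\
  (* (ii) orbits *)
  [/\ forall g, shiftG R d g ->
        [set g *m v | v in cohset d n z] = cohset d n z,
      forall v, cohset d n z v -> stab_of (shiftG R d) v = [set 1%:M],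
      [/\ partition `I_(n %/ d) (cohorbit d n z) (cohset d n z),
          [set orbit_of (shiftG R d) v | v in cohset d n z] =
            [set cohorbit d n z mu | mu in `I_(n %/ d)] &
          forall mu, (mu < n %/ d)%N -> (cohorbit d n z mu #= `I_d)%card] &
      forall k mu nu, (k < d)%N -> (mu < n %/ d)%N -> (nu < n %/ d)%N ->
        braket (coh2 d n z k mu) (coh2 d n z k nu) = (mu == nu)%:R]
  /\
  (* (iii) discrete isotropy *)
  ((forall r r' : 'I_n,
      perm_eq
        [seq `|braket (coh d n z r) (coh d n z s)| ^+ 2 | s : 'I_n]
        [seq `|braket (coh d n z r') (coh d n z s)| ^+ 2 | s : 'I_n])
   /\
   (forall nu : nat, (0 < nu)%N -> forall r r' : 'I_n,
      \sum_(s < n) `|braket (coh d n z r) (coh d n z s)| ^+ nu =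
      \sum_(s < n) `|braket (coh d n z r') (coh d n z s)| ^+ nu))
  /\
  (* (iv) reproducing kernel *)
  [/\ repker d n z *m repker d n z = repker d n z,
      (repker d n z) ^t* = repker d n z,
      \rank (repker d n z) = d &
      forall (f : 'cV[R[i]]_d) (s : 'I_n),
        \sum_(r < n) repker d n z s r * symbol d n z f r = symbol d n z f s].
Proof.
have [ orth full supp iso] := fiducial_coord hdn hz.
have [m_bounds n_eq] : (0 < n %/ d < d)%N /\ n = (n %/ d * d)%N.
  by move: hdn; rewrite !inE => /or3P[] /eqP[-> ->].
have braket_iso j mu nu : (j < d)%N -> (mu < n %/ d)%N -> (nu < n %/ d)%N ->
    `|braket (coh2 d n z 0 mu) (coh2 d n z j nu)| =
    `|braket (coh2 d n z 0 0) (coh2 d n z j (match_index (n %/ d) j mu nu))|.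
  have E la ka : braket (coh2 d n z 0 la) (coh2 d n z j ka) =
      \sum_(i < d) (start_coord d n z la i)^*%R
                   * start_coord d n z ka ((i + j) %% d)%N.
    rewrite braket_coh2E.
    by apply: eq_bigr => i _; rewrite addn0 (modn_small (ltn_ord i)).
  by move=> jd mud nud; rewrite !E; apply: iso.
pose relabel r s := let j := ((s %% d + d - r %% d) %% d)%N in
  (match_index (n %/ d) j (r %/ d) (s %/ d) * d + j)%N.
have relabel_perm r : (r < n)%N ->
    perm_eq [seq relabel r s | s <- iota 0 n] (iota 0 n).
  (* Bounding r by membership in [iota 0 n] leaves a closed boolean, evaluated for n = 6, 8, 12. *)
  suff /allP relabel_all : all (fun r =>
      perm_eq [seq relabel r s | s <- iota 0 n] (iota 0 n)) (iota 0 n).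
    by move=> rn; apply: relabel_all; rewrite mem_iota.
  by rewrite /relabel; move: hdn; rewrite !inE => /or3P[] /eqP[-> ->]; vm_compute.
have rows := perm_braket_row m_bounds n_eq braket_iso relabel_perm.
split; first exact: resolution_of_identity m_bounds n_eq full.
split.
  split.
  - exact: cohset_invariant m_bounds n_eq.
  - exact: stab_coh m_bounds n_eq orth supp.
  - split.
    + exact: cohorbit_partition m_bounds n_eq orth supp.
    + exact: cohset_orbits m_bounds n_eq.
    + exact: card_cohorbit m_bounds n_eq orth supp.
  - by move=> k mu nu _; apply: braket_coh2 orth _ _ _.
split; last first.
  split.
  - exact: repker_idem m_bounds n_eq full.
  - exact: repker_herm.
  - exact: repker_rank m_bounds n_eq full.
  - exact: repker_symbol m_bounds n_eq full.
(* Both claims of (iii) come from the multiset of moduli: raise it to a power, then, for the second,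
   sum. *)
have row_pow k r r' := perm_image_comp (fun x => x ^+ k) (rows r r').
by split=> [r r'|nu _ r r']; [exact: row_pow|exact/sum_perm_image/row_pow].
Qed.
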